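(* Each closed Lie subalgebra $\mathcal{M}$ of a strongly $\mathcal{F}$-semisimple Banach Lie algebra $\mathcal{L}$ is strongly $\mathcal{F}$-semisimple.
   Context: A Banach Lie algebra is a complex Lie algebra $\mathcal{L}$ which is a Banach space in some norm such that, for some constant $t_{\mathcal{L}}>0$, $\|[a,b]\|\leq t_{\mathcal{L}}\|a\|\|b\|$ for all $a,b\in\mathcal{L}$. For a non-empty family $G$ of closed subspaces of a Banach space put $\mathfrak{p}(G)=\bigcap_{Y\in G}Y$ and $\mathfrak{s}(G)=\overline{\sum_{Y\in G}Y}$. $G$ is complete if $\mathfrak{p}(G')\in G$ and $\mathfrak{s}(G')\in G$ for every $\varnothing\neq G'\subseteq G$. $G$ is a lower finite-gap family if for each $Z\in G$ with $Z\neq\mathfrak{p}(G)$ there is $Y\in G$ with $Y\subset Z$ and $0<\dim(Z/Y)<\infty$. A chain is a family of closed subspaces linearly ordered by inclusion; a complete chain $C$ is between $V$ and $W$ if $\mathfrak{p}(C)=V$ and $\mathfrak{s}(C)=W$. A Banach Lie algebra $\mathcal{L}$ is strongly $\mathcal{F}$-semisimple (strongly Frattini-semisimple) if there is a complete, lower finite-gap chain of closed Lie ideals of $\mathcal{L}$ between $\{0\}$ and $\mathcal{L}$. *)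

(* Defs.v *)
From HB Require Import structures.
From mathcomp Require Import all_boot all_order all_algebra.
From mathcomp Require Export complex.
From mathcomp Require Import boolp classical_sets functions reals topology.
From mathcomp Require Import normedtype.

Set Implicit Arguments.
Unset Strict Implicit.
Unset Printing Implicit Defensive.

Import Order.TTheory GRing.Theory Num.Theory.

Local Open Scope classical_set_scope.
Local Open Scope ring_scope.
Local Open Scope complex_scope.

(* The norm of a normed module over [R[i]] takes its values in [R[i]], where
   [0 < t] forces [t] to be real. *)
HB.mixin Record isBanachLie (R : realType) L & CompleteNormedModule R[i] L := {
  lie : L -> L -> L;
  lie_linearl : forall (k : R[i]) (a b c : L),
    lie (k *: a + b) c = k *: lie a c + lie b c;
  lie_linearr : forall (k : R[i]) (a b c : L),
    lie a (k *: b + c) = k *: lie a b + lie a c;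
  liexx : forall a : L, lie a a = 0;
  lie_jacobi : forall a b c : L,
    lie a (lie b c) + lie b (lie c a) + lie c (lie a b) = 0;
  lie_bounded : exists2 t : R[i], 0 < t &
    forall a b : L, `|lie a b| <= t * `|a| * `|b|
}.

#[short(type="banachLieType")]
HB.structure Definition BanachLie (R : realType) :=
  {L of CompleteNormedModule R[i] L & isBanachLie R L}.

Section Families.
Context {K : numFieldType} {X : normedModType K}.
Implicit Types (Y Z V W : set X) (G C : set (set X)).

Definition closed_subspace Y : Prop := closed Y /\ submod_closed [in Y].

Definition fam_meet G : set X := \bigcap_(Y in G) Y.

Definition fam_sum G : set X :=
  [set x | exists2 s : seq X,
     {in s, forall y, (\bigcup_(Y in G) Y) y} & x = \sum_(y <- s) y].

Definition fam_join G : set X := closure (fam_sum G).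

Definition complete_family G : Prop :=
  forall G', G' !=set0 -> G' `<=` G -> G (fam_meet G') /\ G (fam_join G').

(* [dim (Z / Y) = n]: the cosets of [e 0], ..., [e n.-1] form a basis of the
   quotient space [Z / Y]. *)
Definition quotient_dim Z Y (n : nat) : Prop :=
  exists2 e : 'I_n -> X, (forall i, Z (e i)) &
    forall z, Z z -> exists! c : 'rV[K]_n, Y (z - \sum_i c 0 i *: e i).

Definition lower_finite_gap G : Prop :=
  forall Z, G Z -> Z <> fam_meet G ->
    exists Y, [/\ G Y, Y `<=` Z & exists2 n, (0 < n)%N & quotient_dim Z Y n].

Definition subspace_chain C : Prop :=
  [/\ C !=set0, (forall Y, C Y -> closed_subspace Y)
    & forall Y Z, C Y -> C Z -> Y `<=` Z \/ Z `<=` Y].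

Definition between C V W : Prop := fam_meet C = V /\ fam_join C = W.

End Families.

Section BanachLieTheory.
Context {R : realType} {L : banachLieType R}.

Definition closed_lie_ideal (J : set L) : Prop :=
  closed_subspace J /\ forall a x : L, J x -> J (lie a x).

Definition closed_lie_subalgebra (M : set L) : Prop :=
  closed_subspace M /\ forall a b : L, M a -> M b -> M (lie a b).

End BanachLieTheory.

Definition strongly_frattini_semisimple (R : realType) (L : banachLieType R) :
    Prop :=
  exists C : set (set L),
    [/\ subspace_chain C, (forall J, C J -> closed_lie_ideal J),
        complete_family C, lower_finite_gap C & between C [set 0] [set: L]].

(* A closed Lie subalgebra, with the restricted norm and bracket, as a Banach
   Lie algebra.  The proof [hM] is an argument of the predicate and of the type
   so that the instances below can be inferred. *)
Section Subalgebra.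
Context {R : realType} {L : banachLieType R} {M : set L}.

Definition subalg_pred (hM : closed_lie_subalgebra M) : {pred L} := [in M].

Definition subalg (hM : closed_lie_subalgebra M) : Type :=
  {x : L | x \in subalg_pred hM}.

Variable hM : closed_lie_subalgebra M.

Lemma subalg_submod_closed : submod_closed (subalg_pred hM).
Proof. by have [[_ ?] _] := hM. Qed.

HB.instance Definition _ := GRing.isSubmodClosed.Build _ _ (subalg_pred hM)
  subalg_submod_closed.

HB.instance Definition _ := SubChoice.on (subalg hM).

HB.instance Definition _ := [SubChoice_isSubLmodule of subalg hM by <:].

Definition subalg_norm (x : subalg hM) : R[i] := `|val x|.

Lemma subalg_ler_normD (x y : subalg hM) :
  subalg_norm (x + y) <= subalg_norm x + subalg_norm y.
Proof. exact: ler_normD. Qed.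

Lemma subalg_normrZ (k : R[i]) (x : subalg hM) :
  subalg_norm (k *: x) = `|k| * subalg_norm x.
Proof. exact: normrZ. Qed.

Lemma subalg_normr0_eq0 (x : subalg hM) : subalg_norm x = 0 -> x = 0.
Proof. by move=> /normr0_eq0 x0; apply: val_inj. Qed.

HB.instance Definition _ := Lmodule_isNormed.Build R[i] (subalg hM)
  subalg_ler_normD subalg_normrZ subalg_normr0_eq0.

Lemma subalg_cauchy_cvg (F : set_system (subalg hM)) :
  ProperFilter F -> cauchy F -> cvg F.
Proof.
move=> FF /cauchy_ballP Fc.
have Gc : cauchy ((val : subalg hM -> L) @ F).
  apply/cauchy_ballP => e e0.
  have [[A B] /= [FA FB] AB] := Fc _ e0.
  exists (val @` A, val @` B) => /=.
    by split; [apply: filterS FA | apply: filterS FB] => x ?; exists x.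
  move=> [_ _] /= [[x Ax <-] [y By <-]].
  by have := AB (x, y) (conj Ax By); rewrite -!ball_normE.
have /cauchy_cvgP/cvg_ex[/= l Fl] := Gc.
have Ml : l \in subalg_pred hM.
  rewrite inE; have [[cM _] _] := hM.
  apply: (closed_cvg M cM _ l Fl).
  by apply: nearW => x; have := valP x; rewrite inE.
apply/cvg_ex; exists (exist _ l Ml : subalg hM).
apply/cvgrPdist_lt => e e0.
by have /cvgrPdist_lt/(_ e e0) := Fl.
Qed.

HB.instance Definition _ := Uniform_isComplete.Build (subalg hM)
  subalg_cauchy_cvg.

Lemma subalg_lie_subproof (x y : subalg hM) :
  lie (val x) (val y) \in subalg_pred hM.
Proof.
have [_ lieM] := hM; rewrite inE.
by apply: lieM; [have := valP x | have := valP y]; rewrite inE.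
Qed.

Definition subalg_lie (x y : subalg hM) : subalg hM :=
  exist _ (lie (val x) (val y)) (subalg_lie_subproof x y).

Lemma subalg_lie_linearl (k : R[i]) (a b c : subalg hM) :
  subalg_lie (k *: a + b) c = k *: subalg_lie a c + subalg_lie b c.
Proof. by apply: val_inj; exact: lie_linearl. Qed.

Lemma subalg_lie_linearr (k : R[i]) (a b c : subalg hM) :
  subalg_lie a (k *: b + c) = k *: subalg_lie a b + subalg_lie a c.
Proof. by apply: val_inj; exact: lie_linearr. Qed.

Lemma subalg_liexx (a : subalg hM) : subalg_lie a a = 0.
Proof. by apply: val_inj; exact: liexx. Qed.

Lemma subalg_lie_jacobi (a b c : subalg hM) :
  subalg_lie a (subalg_lie b c) + subalg_lie b (subalg_lie c a) +
  subalg_lie c (subalg_lie a b) = 0.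
Proof. by apply: val_inj; exact: lie_jacobi. Qed.

Lemma subalg_lie_bounded : exists2 t : R[i], 0 < t &
  forall a b : subalg hM, `|subalg_lie a b| <= t * `|a| * `|b|.
Proof. by have [t t0 tb] := @lie_bounded R L; exists t => // a b; exact: tb. Qed.

HB.instance Definition _ := isBanachLie.Build R (subalg hM)
  subalg_lie_linearl subalg_lie_linearr subalg_liexx subalg_lie_jacobi
  subalg_lie_bounded.

End Subalgebra.

(* Main.v *)
Require Import Defs.
From mathcomp Require Import all_boot all_order all_algebra.
From mathcomp Require Import boolp classical_sets functions reals topology.
From mathcomp Require Import normedtype.

Local Open Scope classical_set_scope.
Local Open Scope ring_scope.

Import GRing.Theory.

(** Let [C] be a complete, lower finite-gap chain of closed ideals of [L]
    between [{0}] and [L].  The traces [J `&` M], for [J] in [C], form a chain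
    of closed ideals of [M], and this chain has the required properties.

    The one difficulty is completeness under joins, since in general the
    closure of a union of traces can be smaller than the trace of the closure of
    the union.  It is overcome by the observation that [C] is well-ordered by
    reverse inclusion: every nonempty subfamily [G] of [C] has a largest member
    ([chain_has_max]).  Indeed the join [Z] of [G] is in [C]; if it is not the
    least member of [C], it contains a [Y] in [C] with [0 < dim (Z / Y) < oo],
    some member of [G] is not contained in [Y], and among the members of [G]
    containing [Y] one that contains the longest family linearly independent
    modulo [Y] is the largest member of [G].  A nonempty family of traces thus
    has a largest member too, which is its join.

    For the gaps, let [Z] be a nonzero trace.  The intersection [J] of all
    members of [C] with trace [Z] is in [C] and has trace [Z]; a member of
    [C] of finite positive codimension in [J] has by minimality a trace smaller
    than [Z], and the quotient of the traces embeds in that of the ideals. *)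

(** * Linear independence modulo a subspace *)

Section QuotientDimension.
Context {K : numFieldType} {X : normedModType K}.
Implicit Types (Y Z W : set X).

Lemma submod0 Y : submod_closed [in Y] -> Y 0.
Proof. by case=> /set_mem. Qed.

Lemma submodP Y (k : K) (x y : X) :
  submod_closed [in Y] -> Y x -> Y y -> Y (k *: x + y).
Proof. by case=> _ h Yx Yy; apply/set_mem/h; exact/mem_set. Qed.

Lemma submodZ Y (k : K) (x : X) : submod_closed [in Y] -> Y x -> Y (k *: x).
Proof.
move=> h Yx; rewrite -[_ *: _]addr0.
by apply: submodP => //; exact: submod0.
Qed.

Lemma submodD Y (x y : X) : submod_closed [in Y] -> Y x -> Y y -> Y (x + y).
Proof. by move=> h Yx Yy; rewrite -[x]scale1r; apply: submodP. Qed.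

Lemma submodB Y (x y : X) : submod_closed [in Y] -> Y x -> Y y -> Y (x - y).
Proof. by move=> h Yx Yy; rewrite addrC -scaleN1r; apply: submodP. Qed.

Lemma submod_sum Y (I : Type) (r : seq I) (F : I -> X) :
  submod_closed [in Y] -> (forall i, Y (F i)) -> Y (\sum_(i <- r) F i).
Proof.
move=> h YF; elim/big_ind: _ => //; first exact: submod0.
by move=> x y; exact: submodD.
Qed.

(** The linear combination of [e 0], ..., [e m.-1] with coefficients [c]. *)
Definition lincomb m (e : 'I_m -> X) (c : 'rV[K]_m) : X :=
  \sum_i c 0 i *: e i.

Lemma lincombP m (e : 'I_m -> X) (k : K) (c d : 'rV[K]_m) :
  lincomb m e (k *: c + d) = k *: lincomb m e c + lincomb m e d.
Proof.
rewrite /lincomb scaler_sumr -big_split; apply: eq_bigr => i _.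
by rewrite !mxE scalerDl scalerA.
Qed.

Lemma lincomb0 m (e : 'I_m -> X) : lincomb m e 0 = 0.
Proof. by rewrite /lincomb big1 // => i _; rewrite mxE scale0r. Qed.

Lemma lincombB m (e : 'I_m -> X) (c d : 'rV[K]_m) :
  lincomb m e (c - d) = lincomb m e c - lincomb m e d.
Proof. by rewrite addrC -scaleN1r lincombP scaleN1r addrC. Qed.

Lemma lincomb_delta m (e : 'I_m -> X) (i : 'I_m) :
  lincomb m e (delta_mx 0 i) = e i.
Proof.
rewrite /lincomb (bigD1 i) //= mxE !eqxx scale1r big1 ?addr0 // => j ji.
by rewrite mxE eqxx (negbTE ji) scale0r.
Qed.

(** Linear independence of the cosets of [e 0], ..., [e m.-1] modulo [Y]. *)
Definition free_mod Y m (e : 'I_m -> X) : Prop :=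
  forall c, Y (lincomb m e c) -> c = 0.

(** [Z] contains [m] vectors which are linearly independent modulo [Y]. *)
Definition has_free_mod Y Z m : Prop :=
  exists2 e : 'I_m -> X, (forall i, Z (e i)) & free_mod Y m e.

Lemma has_free_mod0 Y Z : has_free_mod Y Z 0.
Proof.
by exists (fun=> 0) => [[]//|c _]; apply/rowP => -[].
Qed.

(** A family in [W] which is free modulo [Y] is extended by any [z] of [Z]
    outside [W]: the coefficient of [z] in a combination lying in [Y] vanishes,
    since otherwise [z] would be in [W]. *)
Lemma has_free_modS Y W Z m (e : 'I_m -> X) z :
  submod_closed [in W] -> Y `<=` W -> W `<=` Z ->
  (forall i, W (e i)) -> free_mod Y m e -> Z z -> ~ W z ->
  has_free_mod Y Z m.+1.
Proof.
move=> sW YW WZ We fe Zz Wz.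
exists (fun i => if unlift ord0 i is Some j then e j else z).
  by move=> i; case: unliftP => // j _; apply: WZ.
move=> c; rewrite /lincomb big_ord_recl unlift_none.
under eq_bigr do rewrite liftK.
set s := (X in _ + X); move=> Yc.
have Ws : W s by apply: submod_sum => // i; apply: submodZ.
have c0 : c 0 ord0 = 0.
  have [//|c0] := eqVneq (c 0 ord0) 0; case: Wz.
  rewrite -[z](scalerK c0); apply: submodZ => //.
  by rewrite -(addrK s (c 0 ord0 *: z)); apply: submodB => //; apply: YW.
have /fe/rowP c'0 : Y (lincomb m e (\row_i c 0 (lift ord0 i))).
  move: Yc; rewrite c0 scale0r add0r /lincomb.
  by under [in X in _ -> X]eq_bigr do rewrite mxE.
apply/rowP => i; rewrite mxE; have [j ->|->//] := unliftP ord0 i.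
by have := c'0 j; rewrite !mxE.
Qed.

Lemma quotient_dim_bound Y Z n m : submod_closed [in Y] ->
  quotient_dim Z Y n -> has_free_mod Y Z m -> (m <= n)%N.
Proof.
move=> sY [b _ bP] [e Ze fe]; rewrite leqNgt; apply/negP => nm.
have /choice[a aP] : forall i, exists c, Y (e i - lincomb n b c).
  by move=> i; have [c [? _]] := bP _ (Ze i); exists c.
pose A := \matrix_i a i.
(* Modulo [Y], [lincomb m e u] has coordinates [u *m A] in the basis [b]; as
   [A] has more rows than columns, some nonzero [u] is in its kernel. *)
have Ye u : Y (lincomb m e u - lincomb n b (u *m A)).
  have -> : lincomb n b (u *m A) = \sum_i u 0 i *: lincomb n b (a i).
    rewrite /lincomb; under [RHS]eq_bigr do rewrite scaler_sumr.
    rewrite exchange_big; apply: eq_bigr => j _; rewrite mxE scaler_suml.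
    by apply: eq_bigr => i _; rewrite !mxE scalerA.
  rewrite -sumrB; apply: submod_sum => // i; rewrite -scalerBr.
  exact: submodZ.
have : kermx A != 0.
  by rewrite kermx_eq0 /row_free neq_ltn (leq_ltn_trans (rank_leq_col A)).
case/rowV0Pn => u /sub_kermxP uA0; case/eqP; apply: fe.
by have := Ye u; rewrite uA0 lincomb0 subr0.
Qed.

Lemma quotient_dim_gt0 Y Z n : submod_closed [in Z] -> (0 < n)%N ->
  quotient_dim Z Y n -> ~ Z `<=` Y.
Proof.
move=> sZ n0 [b Zb bP] ZY; have [c [_ uc]] := bP 0 (submod0 _ sZ).
have Yb d : Y (0 - lincomb n b d).
  apply: ZY; apply: submodB => //; first exact: submod0.
  by apply: submod_sum => // i; apply: submodZ.
have /rowP/(_ (Ordinal n0)) : 0 = const_mx 1 :> 'rV[K]_n.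
  exact: etrans (esym (uc _ (Yb 0))) (uc _ (Yb _)).
by rewrite !mxE => /eqP; rewrite eq_sym oner_eq0.
Qed.

(** A longest family in [Z] which is free modulo [Y] spans [Z] modulo [Y]. *)
Lemma quotient_dim_exists Y Z N :
  submod_closed [in Y] -> submod_closed [in Z] -> Y `<=` Z -> ~ Z `<=` Y ->
  (forall m, has_free_mod Y Z m -> (m <= N)%N) ->
  exists2 n, (0 < n)%N & quotient_dim Z Y n.
Proof.
move=> sY sZ YZ nZY bd.
have exP : exists m, `[< has_free_mod Y Z m >].
  by exists 0%N; apply/asboolP; exact: has_free_mod0.
have ubP m : `[< has_free_mod Y Z m >] -> (m <= N)%N by move/asboolP/bd.
case: (ex_maxnP exP ubP) => n /asboolP[e Ze fe] nmax.
(* [W] is the sum of [Y] and the span of [e]. *)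
pose W := [set x | exists c, Y (x - lincomb n e c)].
have sW : submod_closed [in W].
  split.
    by apply/mem_set; exists 0; rewrite lincomb0 subr0; exact: submod0.
  move=> k x y /set_mem[c xc] /set_mem[d yd].
  apply/mem_set; exists (k *: c + d).
  by rewrite lincombP opprD addrACA -scalerBr; apply: submodP.
have YW : Y `<=` W by move=> x Yx; exists 0; rewrite lincomb0 subr0.
have WZ : W `<=` Z.
  move=> x [c /YZ xc]; rewrite -(subrK (lincomb n e c) x); apply: submodD => //.
  by apply: submod_sum => // i; apply: submodZ.
have We i : W (e i).
  by exists (delta_mx 0 i); rewrite lincomb_delta subrr; exact: submod0.
have ZW z : Z z -> W z.
  move=> Zz; apply: contrapT => Wz.
  have := has_free_modS _ _ _ _ _ _ sW YW WZ We fe Zz Wz.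
  by move/asboolP/nmax; rewrite ltnn.
exists n.
  rewrite lt0n; apply/eqP => n0; apply: nZY => z /ZW[c].
  suff -> : lincomb n e c = 0 by rewrite subr0.
  by rewrite /lincomb big1 // => -[i ilt]; exfalso; rewrite n0 in ilt.
exists e => // z /ZW[c zc]; exists c; split=> // d zd.
apply/eqP; rewrite -subr_eq0; apply/eqP/fe; rewrite lincombB.
have -> : lincomb n e c - lincomb n e d =
          (z - lincomb n e d) - (z - lincomb n e c).
  by rewrite opprB [RHS]addrC addrA subrK.
exact: submodB.
Qed.

End QuotientDimension.

(** * Chains of closed subspaces *)

Section Chains.
Context {K : numFieldType} {X : normedModType K}.
Implicit Types (Y Z W : set X) (G C : set (set X)).

Lemma sub_fam_join G Y : G Y -> Y `<=` fam_join G.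
Proof.
move=> GY y Yy; apply: subset_closure; exists [:: y]; last by rewrite big_seq1.
by move=> x; rewrite inE => /eqP ->; exists Y.
Qed.

Lemma fam_join_sub G W : closed_subspace W -> (forall Y, G Y -> Y `<=` W) ->
  fam_join G `<=` W.
Proof.
move=> [cW sW] GW; have /closure_id -> := cW.
apply: closure_subset => x [s sG ->].
rewrite big_seq_cond; elim/big_ind: _; first exact: submod0.
  by move=> ? ?; exact: submodD.
by move=> i /andP[/sG[Y /GW YW] /YW].
Qed.

(** A complete, lower finite-gap chain is well-ordered by reverse inclusion. *)
Lemma chain_has_max C G : subspace_chain C -> complete_family C ->
  lower_finite_gap C -> G !=set0 -> G `<=` C ->
  exists2 W, G W & forall Y, G Y -> Y `<=` W.
Proof.
move=> [_ Csub Ctot] Ccomp Cgap G0 GC.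
have [_ CZ] := Ccomp _ G0 GC; set Z := fam_join G in CZ.
have [Zm|Zm] := EM (Z = fam_meet C).
  case: G0 => W GW; exists W => // Y /sub_fam_join YZ.
  by apply: subset_trans YZ _; rewrite -/Z Zm; apply: bigcap_inf; exact: GC.
have [Y [CY YZ [n n0 dn]]] := Cgap _ CZ Zm.
have [[_ sZ] [_ sY]] := (Csub _ CZ, Csub _ CY).
have [W GW WY] : exists2 W, G W & ~ W `<=` Y.
  apply: contrapT => h; apply: (quotient_dim_gt0 _ _ _ sZ n0 dn).
  apply: fam_join_sub; first exact: Csub.
  by move=> W GW; apply: contrapT => WY; apply: h; exists W.
have YW : Y `<=` W by case: (Ctot _ _ CY (GC _ GW)).
pose P m := exists V, [/\ G V, Y `<=` V & has_free_mod Y V m].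
have exP : exists m, `[< P m >].
  by exists 0%N; apply/asboolP; exists W; split=> //; exact: has_free_mod0.
(* A family in a member of [G] is a family in [Z], which bounds its length. *)
have ubP m : `[< P m >] -> (m <= n)%N.
  move=> /asboolP[V [GV _ [e Ve fe]]].
  apply: (quotient_dim_bound _ _ _ _ sY dn).
  by exists e => // i; apply: sub_fam_join GV _ _.
case: (ex_maxnP exP ubP) => m /asboolP[V [GV YV [e Ve fe]]] mmax.
exists V => // U GU z Uz; apply: contrapT => Vz.
have VU : V `<=` U.
  by case: (Ctot _ _ (GC _ GV) (GC _ GU)) => // UV; case: Vz; exact: UV.
have [_ sV] := Csub _ (GC _ GV).
have /asboolP/mmax : P m.+1.
  exists U; split=> //; first exact: subset_trans VU.
  exact: has_free_modS sV YV VU Ve fe Uz Vz.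
by rewrite ltnn.
Qed.

End Chains.

(** * Traces on a closed subalgebra *)

Section Trace.
Context {R : realType} {L : banachLieType R} {M : set L}.
Variable hM : closed_lie_subalgebra M.

(** The trace [J `&` M] of [J], as a subset of the Banach Lie algebra [M]. *)
Definition trace (J : set L) : set (subalg hM) := val @^-1` J.

Lemma trace_meet (G : set (set L)) :
  fam_meet (trace @` G) = trace (fam_meet G).
Proof. by rewrite /fam_meet bigcap_image /trace preimage_bigcap. Qed.

Lemma continuous_val_subalg : continuous (val : subalg hM -> L).
Proof.
move=> x A /nbhs_ballP[e e0 eA]; apply/nbhs_ballP; exists e => // y.
by rewrite -ball_normE => xy; apply: eA; rewrite -ball_normE.
Qed.

Lemma trace_submod J : submod_closed [in J] -> submod_closed [in trace J].
Proof.
move=> sJ; split.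
  by apply/mem_set; rewrite /trace /preimage /mkset raddf0; exact: submod0.
move=> k x y /set_mem Jx /set_mem Jy; apply/mem_set.
by rewrite /trace /preimage /mkset linearP; exact: submodP.
Qed.

Lemma trace_closed_lie_ideal J :
  closed_lie_ideal J -> closed_lie_ideal (trace J).
Proof.
move=> [[cJ sJ] iJ]; split; last by move=> a x; exact: iJ.
split; last exact: trace_submod.
by apply: preimage_closed => // x _; exact: continuous_val_subalg.
Qed.

Lemma trace_has_free_mod (Y Z : set L) m :
  has_free_mod (trace Y) (trace Z) m -> has_free_mod Y Z m.
Proof.
move=> [e Ze fe]; exists (fun i => val (e i)) => // c Yc; apply: fe.
rewrite /trace /preimage /mkset /lincomb raddf_sum.
suff -> : \sum_i val (c 0 i *: e i) = lincomb m (fun i => val (e i)) c by [].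
by apply: eq_bigr => i _; rewrite linearZ.
Qed.

End Trace.

Theorem corollary8p22 (R : realType) (L : banachLieType R)
  (hL : strongly_frattini_semisimple L)
  (M : set L) (hM : closed_lie_subalgebra M) :
  strongly_frattini_semisimple (subalg hM).
Proof.
case: hL => C [Cch Cid Ccomp Cgap [Cmeet Cjoin]].
have [C0 Csub Ctot] := Cch.
pose tr := trace hM.
have Tid J : (tr @` C) J -> closed_lie_ideal J.
  by move=> [I /Cid CI <-]; exact: trace_closed_lie_ideal.
have Tmeet : fam_meet (tr @` C) = [set 0].
  rewrite trace_meet Cmeet /trace; apply/seteqP; split=> x x0.
    by apply: val_inj; rewrite raddf0.
  by rewrite x0 /preimage /mkset raddf0.
exists (tr @` C); split => //.
- split; first by case: C0 => J CJ; exists (tr J); exists J.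
    by move=> J /Tid[].
  move=> _ _ [I CI <-] [J CJ <-].
  by case: (Ctot _ _ CI CJ) => IJ; [left|right] => x; exact: IJ.
- (* [H] consists of the members of [C] with trace in [G]. *)
  move=> G G0 GC; pose H := [set J | C J /\ G (tr J)].
  have HC : H `<=` C by move=> J [].
  have GE : G = tr @` H.
    apply/seteqP; split=> [Z GZ|_ [J [_ ?] <-]//].
    by have [J CJ trJ] := GC _ GZ; exists J => //; split=> //; rewrite trJ.
  have H0 : H !=set0 by move: G0; rewrite GE => -[_ [J HJ _]]; exists J.
  split; first by rewrite GE trace_meet; exists (fam_meet H) => //; apply Ccomp.
  have [W [CW GW] Wmax] := chain_has_max _ _ Cch Ccomp Cgap H0 HC.
  exists W => //; apply/seteqP; split; first exact: sub_fam_join.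
  apply: fam_join_sub; first by apply (Tid (tr W)); exists W.
  by rewrite GE => _ [J HJ <-] x; exact: Wmax.
- move=> Z TZ; rewrite Tmeet => Z0; pose H := [set J | C J /\ tr J = Z].
  have HC : H `<=` C by move=> J [].
  have H0 : H !=set0 by case: TZ => J CJ JZ; exists J.
  (* [J] is the least member of [C] with trace [Z]. *)
  pose J := fam_meet H; have CJ : C J by apply Ccomp.
  have trJ : tr J = Z.
    rewrite /J /tr -trace_meet; apply/seteqP; split=> [x|x Zx].
      by case: H0 => I HI; apply; exists I => //; case: HI.
    by move=> _ [I [_ trI] <-]; rewrite -/tr trI.
  have J0 : J <> fam_meet C.
    by move=> JE; apply: Z0; rewrite -trJ JE /tr -trace_meet.
  have [Y [CY YJ [n n0 dn]]] := Cgap _ CJ J0.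
  have [[_ sJ] [_ sY]] := (Csub _ CJ, Csub _ CY).
  exists (tr Y); split; [by exists Y| |].
    by rewrite -trJ => x; exact: YJ.
  rewrite -trJ; apply: (@quotient_dim_exists _ _ _ _ n).
  + exact: trace_submod.
  + exact: trace_submod.
  + by move=> x; exact: YJ.
  + move=> JY; apply: (quotient_dim_gt0 _ _ _ sJ n0 dn).
    apply: bigcap_inf; split=> //; rewrite -trJ; apply/seteqP; split=> // x.
    exact: YJ.
  + by move=> m /trace_has_free_mod; exact: quotient_dim_bound.
- split=> //; apply/seteqP; split=> // x _.
  apply: (@sub_fam_join _ _ _ (tr (fam_join C))); last by rewrite Cjoin.
  by exists (fam_join C) => //; apply Ccomp.
Qed.
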